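(* Let $\sigma\ge 0$. There exist a sequence $(\phi_n)_{n\ge 1}$ bounded in $H^{\sigma}(\mathbb T^2)$ and a countable set $E\subset\mathbb R$ such that for every $t\in\mathbb R\setminus E$ and every $\sigma_1>\sigma$, $$\lim_{n\to\infty}\Big\|\frac1i\int_0^t e^{i(t-t')\Delta}\big(:|e^{it'\Delta}\phi_n|^2e^{it'\Delta}\phi_n:\big)\,dt'\Big\|_{H^{\sigma_1}(\mathbb T^2)}=+\infty .$$
   Context: $\mathbb T^2=\mathbb R^2/(2\pi\mathbb Z)^2$, $\Delta$ is the Laplacian on $\mathbb T^2$, and $e^{it\Delta}$ is the free Schrödinger group. The renormalised cubic nonlinearity is $$:|v|^2v:\;=\;|v|^2v-\frac{1}{2\pi^2}\|v\|_{L^2(\mathbb T^2)}^2\,v .$$ The $H^{\sigma_1}$ norm is understood as taking the value $+\infty$ when the function is not in $H^{\sigma_1}$. *)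

(* Defs.v *)
From mathcomp Require Import all_boot all_order all_algebra.
From mathcomp Require Import all_classical all_reals all_analysis.
From mathcomp.real_closed Require Import complex.

Set Implicit Arguments.
Unset Strict Implicit.
Unset Printing Implicit Defensive.

Import Order.TTheory GRing.Theory Num.Theory.
Import numFieldNormedType.Exports.

Local Open Scope classical_set_scope.
Local Open Scope ring_scope.
Local Open Scope complex_scope.

Section Torus.
Context {R : realType}.

Local Notation mu := (@lebesgue_measure R).
Local Notation mu2 := (@lebesgue_measure R \x @lebesgue_measure R)%E.
Local Notation normc := (@Normc.normc R).

(* A function on T^2 is a function on R^2 that is 2pi-periodic in each
   variable; integrals over T^2 are integrals over the fundamental square. *)
Definition square : set (R * R) := `[0, 2 * pi] `*` `[0, 2 * pi].

Definition periodic (f : R * R -> R[i]) : Prop :=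
  forall x, f (x.1 + 2 * pi, x.2) = f x /\ f (x.1, x.2 + 2 * pi) = f x.

Definition cmeasurable d (T : measurableType d) (D : set T) (f : T -> R[i]) :=
  measurable_fun D (fun x => complex.Re (f x)) /\ measurable_fun D (fun x => complex.Im (f x)).

Definition cintegral d (T : measurableType d) (m : {measure set T -> \bar R})
    (D : set T) (f : T -> R[i]) : R[i] :=
  Rintegral m D (fun x => complex.Re (f x)) +i* Rintegral m D (fun x => complex.Im (f x)).

Definition L1T2 (f : R * R -> R[i]) : Prop :=
  [/\ periodic f, cmeasurable square f &
      mu2.-integrable square (fun x => (normc (f x))%:E)].

Definition L2T2 (f : R * R -> R[i]) : Prop :=
  [/\ periodic f, cmeasurable square f &
      mu2.-integrable square (fun x => (normc (f x) ^+ 2)%:E)].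

Definition normL1 (f : R * R -> R[i]) : R :=
  Rintegral mu2 square (fun x => normc (f x)).

Definition normL2 (f : R * R -> R[i]) : R :=
  Num.sqrt (Rintegral mu2 square (fun x => normc (f x) ^+ 2)).

Definition expi (theta : R) : R[i] := cos theta +i* sin theta.

Definition dot (k : int * int) (x : R * R) : R :=
  k.1%:~R * x.1 + k.2%:~R * x.2.

Definition sqnorm (k : int * int) : R := (k.1 ^+ 2 + k.2 ^+ 2)%:~R.

Definition fourier (f : R * R -> R[i]) (k : int * int) : R[i] :=
  ((4 * pi ^+ 2)^-1)%:C *
  cintegral mu2 square (fun x => expi (- dot k x) * f x).

(* A distribution on T^2 is represented by the family of its Fourier
   coefficients, a function on Z^2; an integrable function f is identified
   with the distribution [fourier f]. *)
Definition distr := int * int -> R[i].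

(* (sum_k (1 + |k|^2)^s |2 pi a_k|^2)^(1/2), so that the norm for s = 0 is the
   L^2 norm. The sum is taken in [0, +oo]: the value is +oo exactly when a is
   not in H^s. *)
Definition normH (s : R) (a : distr) : \bar R :=
  poweR (\esum_(k in [set: int * int])
    ((1 + sqnorm k) `^ s * (2 * pi * normc (a k)) ^+ 2)%:E) 2^-1.

(* For s >= 0 the space H^s(T^2) consists of functions. *)
Definition Hs (s : R) (f : R * R -> R[i]) : Prop :=
  L2T2 f /\ (normH s (fourier f) < +oo)%E.

Definition schrodinger (t : R) (a : distr) : distr :=
  fun k => expi (- (t * sqnorm k)) * a k.

Definition partial_sum (a : distr) (N : nat) (x : R * R) : R[i] :=
  \sum_(i < N.*2.+1) \sum_(j < N.*2.+1)
    let k := (i%:Z - N%:Z, j%:Z - N%:Z) in a k * expi (dot k x).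

(* The L^2 function with Fourier series a, unique up to a null set. It exists
   whenever a is square summable; otherwise the value 0 is a dummy. *)
Definition synthesis (a : distr) : R * R -> R[i] :=
  xget (fun=> 0) [set g | L2T2 g /\
    (fun N => \int[mu2]_(x in square)
      (normc (g x - partial_sum a N x) ^+ 2)%:E)%E @ \oo --> (0 : \bar R)%E].

Definition free_evolution (phi : R * R -> R[i]) (t : R) : R * R -> R[i] :=
  synthesis (schrodinger t (fourier phi)).

Definition wick_cubic (v : R * R -> R[i]) : R * R -> R[i] :=
  fun x => `|v x| ^+ 2 * v x - (normL2 v ^+ 2 / (2 * pi ^+ 2))%:C * v x.

Definition oriented_integral (a b : R) (f : R -> R[i]) : R[i] :=
  if a <= b then cintegral mu `[a, b] f else - cintegral mu `[b, a] f.

(* Local Bochner integrability of s |-> F s as an L^1(T^2)-valued map. By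
   Pettis' theorem, strong measurability amounts to measurability of all the
   Fourier coefficients, as L^1(T^2) is separable and trigonometric polynomials
   are norming for it. *)
Definition locally_integrable_L1 (F : R -> R * R -> R[i]) : Prop :=
  [/\ {ae mu, forall s, L1T2 (F s)},
      forall k, cmeasurable [set: R] (fun s => fourier (F s) k) &
      forall a b, mu.-integrable `[a, b] (fun s => (normL1 (F s))%:E)].

(* The nonlinear term need not be square integrable, so the group acts on it
   in the sense of distributions, and the time integral is taken coefficient
   by coefficient. It is meaningful when [locally_integrable_L1] holds for
   s |-> wick_cubic (free_evolution phi s). *)
Definition picard (phi : R * R -> R[i]) (t : R) : distr :=
  fun k => ('i%C)^-1 * oriented_integral 0 t (fun s =>
    schrodinger (t - s) (fourier (wick_cubic (free_evolution phi s))) k).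

End Torus.

(* Main.v *)
Require Import Defs.
From mathcomp Require Import all_boot all_order all_algebra.
From mathcomp Require Import all_classical all_reals all_analysis.
From mathcomp Require Import measurable_realfun.
From mathcomp Require Import ring zify.
From mathcomp.real_closed Require Import complex.

Set Implicit Arguments.
Unset Strict Implicit.
Unset Printing Implicit Defensive.

Import Order.TTheory GRing.Theory Num.Theory.
Import numFieldNormedType.Exports.

Local Open Scope classical_set_scope.
Local Open Scope ring_scope.

(** The blow-up comes from one exactly resonant interaction between two low modes
    and one high mode. For [N >= 1] take the data

      [phi = 1 + exp (i x_1) + a exp (i N x_2)],  with [a = (1 + N^2)^(-sigma/2)],

    whose [H^sigma] norm does not depend on [N]. Among all triples of frequencies
    of the data, only the two orderings of [(1, 0) - (0, 0) + (0, N)] contribute to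
    the mode [(1, N)] of the cubic term ([out_freqE]). The four points
    [(0, 0)], [(1, 0)], [(1, N)], [(0, N)] form a rectangle, so
    [|(1, 0)|^2 + |(0, N)|^2 = |(0, 0)|^2 + |(1, N)|^2] and the integrand of the
    Duhamel term at [(1, N)] is constant in time ([resonant_coef]). The mode
    [(1, N)] is absent from the data, hence the renormalisation, which is a
    multiple of [v], does not affect it. The coefficient of the Picard iterate at
    [(1, N)] thus has modulus exactly [2 |t| a] ([picard_out_freq]), and its
    weight in [H^sigma1] is at least of order [t^2 N^(sigma1 - sigma)]. This tends
    to infinity for every [t <> 0], so the exceptional set is [{0}].

    The rest makes this computation legitimate for the objects at hand. The data
    being a trigonometric polynomial, so are its evolution and the cubic term, and
    [fourier_trig] reads off all coefficients by orthogonality of characters. The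
    free evolution is defined only up to a null set, as a limit in quadratic mean;
    [synthesis_trig] identifies it with a trigonometric polynomial almost
    everywhere, and every quantity involved is insensitive to null sets. The local
    integrability in time follows because the coefficients of the cubic term are
    continuous functions of time of constant modulus. *)

(** * Complex-valued measurable and integrable functions *)

Definition cintegrable {R : realType} d (T : measurableType d)
    (m : {measure set T -> \bar R}) (D : set T) (f : T -> R[i]) :=
  m.-integrable D (EFin \o (@complex.Re R \o f)) /\
  m.-integrable D (EFin \o (@complex.Im R \o f)).

Section ComplexIntegral.
Local Open Scope complex_scope.
Context {R : realType}.
Local Notation normc := (@Normc.normc R).
Local Notation Re := (@complex.Re R).
Local Notation Im := (@complex.Im R).

Lemma ReM (a b : R[i]) : Re (a * b) = Re a * Re b - Im a * Im b.
Proof. by case: a => ? ?; case: b. Qed.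

Lemma ImM (a b : R[i]) : Im (a * b) = Re a * Im b + Im a * Re b.
Proof. by case: a => ? ?; case: b. Qed.

Lemma ReD (a b : R[i]) : Re (a + b) = Re a + Re b.
Proof. by case: a => ? ?; case: b. Qed.

Lemma ImD (a b : R[i]) : Im (a + b) = Im a + Im b.
Proof. by case: a => ? ?; case: b. Qed.

Lemma normc_ge0 (a : R[i]) : 0 <= normc a.
Proof. by case: a => ? ?; exact: sqrtr_ge0. Qed.

Lemma normcE2 (a : R[i]) : normc a ^+ 2 = Re a ^+ 2 + Im a ^+ 2.
Proof. by case: a => x y /=; rewrite sqr_sqrtr// addr_ge0// sqr_ge0. Qed.

Lemma le_Re_normc (a : R[i]) : `|Re a| <= normc a.
Proof.
rewrite -(@ler_pXn2r _ 2) ?nnegrE ?normc_ge0 ?normr_ge0// normcE2 real_normK ?num_real//.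
by rewrite lerDl sqr_ge0.
Qed.

Lemma le_Im_normc (a : R[i]) : `|Im a| <= normc a.
Proof.
rewrite -(@ler_pXn2r _ 2) ?nnegrE ?normc_ge0 ?normr_ge0// normcE2 real_normK ?num_real//.
by rewrite lerDr sqr_ge0.
Qed.

Lemma le_normc_sum (I : Type) (s : seq I) (F : I -> R[i]) :
  normc (\sum_(i <- s) F i) <= \sum_(i <- s) normc (F i).
Proof.
elim/big_ind2 : _ => [|x y z w xy zw|//]; first by rewrite Normc.normc0.
exact: le_trans (le_normcD _ _) (lerD xy zw).
Qed.

Context d {T : measurableType d}.
Variable (D : set T).
Hypothesis mD : measurable D.
Implicit Types f g : T -> R[i].

Lemma cmeasurable_cst (c : R[i]) : cmeasurable D (fun=> c).
Proof. by split; exact: measurable_cst. Qed.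

Lemma cmeasurableD f g : cmeasurable D f -> cmeasurable D g ->
  cmeasurable D (fun x => f x + g x).
Proof.
move=> [f1 f2] [g1 g2]; split.
- by under eq_fun do rewrite ReD; exact: measurable_funD.
- by under eq_fun do rewrite ImD; exact: measurable_funD.
Qed.

Lemma cmeasurableM f g : cmeasurable D f -> cmeasurable D g ->
  cmeasurable D (fun x => f x * g x).
Proof.
move=> [f1 f2] [g1 g2]; split.
- under eq_fun do rewrite ReM.
  by apply: measurable_funB; exact: measurable_funM.
- under eq_fun do rewrite ImM.
  by apply: measurable_funD; exact: measurable_funM.
Qed.

Lemma cmeasurable_conj f : cmeasurable D f -> cmeasurable D (fun x => conjc (f x)).
Proof.
move=> [f1 f2]; split.
- by apply: eq_measurable_fun f1 => x _; case: (f x).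
- have : measurable_fun D (fun x => - Im (f x)) by exact: measurableT_comp.
  by apply: eq_measurable_fun => x _; case: (f x).
Qed.

Lemma cmeasurable_sum (I : Type) (s : seq I) (F : I -> T -> R[i]) :
  (forall i, cmeasurable D (F i)) -> cmeasurable D (fun x => \sum_(i <- s) F i x).
Proof.
move=> mF; elim: s => [|i s IH].
  by under eq_fun do rewrite big_nil; exact: cmeasurable_cst.
by under eq_fun do rewrite big_cons; exact: cmeasurableD.
Qed.

Lemma cmeasurable_expi (h : T -> R) : measurable_fun D h ->
  cmeasurable D (fun x => expi (h x)).
Proof.
move=> mh; split => /=.
- apply: measurableT_comp mh; apply: continuous_measurable_fun.
  exact: continuous_cos.
- apply: measurableT_comp mh; apply: continuous_measurable_fun.
  exact: continuous_sin.
Qed.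

Lemma measurable_normc2 f : cmeasurable D f ->
  measurable_fun D (fun x => normc (f x) ^+ 2).
Proof.
move=> [f1 f2]; under eq_fun do rewrite normcE2.
by apply: measurable_funD; exact: measurable_funX.
Qed.

Lemma measurable_normc f : cmeasurable D f -> measurable_fun D (fun x => normc (f x)).
Proof.
move=> mf.
have -> : (fun x => normc (f x)) = (fun x => Num.sqrt (normc (f x) ^+ 2)).
  by apply/funext => x; rewrite sqrtr_sqr ger0_norm// normc_ge0.
have ms : measurable_fun [set: R] (@Num.sqrt R).
  by apply: continuous_measurable_fun; exact: sqrt_continuous.
exact: (measurableT_comp ms (measurable_normc2 mf)).
Qed.

Variable m : {measure set T -> \bar R}.

Lemma cintegralD f g : cintegrable m D f -> cintegrable m D g ->
  cintegral m D (fun x => f x + g x) = cintegral m D f + cintegral m D g.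
Proof.
move=> [f1 f2] [g1 g2]; rewrite /cintegral.
under eq_Rintegral do rewrite ReD.
under [X in _ +i* X]eq_Rintegral do rewrite ImD.
by rewrite !RintegralD.
Qed.

Lemma cintegrable0 : cintegrable m D (fun=> 0).
Proof. by split; exact: integrable0. Qed.

Lemma cintegral0 : cintegral m D (fun=> 0) = 0.
Proof. by rewrite /cintegral /= /Rintegral !integral0. Qed.

Lemma cintegrableD f g : cintegrable m D f -> cintegrable m D g ->
  cintegrable m D (fun x => f x + g x).
Proof.
move=> [f1 f2] [g1 g2]; split.
- by have := integrableD mD f1 g1; apply: eq_integrable => // x _ /=; rewrite -EFinD -ReD.
- by have := integrableD mD f2 g2; apply: eq_integrable => // x _ /=; rewrite -EFinD -ImD.
Qed.

Lemma cintegrableZ (c : R[i]) f : cintegrable m D f -> cintegrable m D (fun x => c * f x).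
Proof.
move=> [f1 f2]; split.
- have := integrableB mD (integrableZl mD (Re c) f1) (integrableZl mD (Im c) f2).
  by apply: eq_integrable => // x _ /=; rewrite -!EFinM -EFinB -ReM.
- have := integrableD mD (integrableZl mD (Re c) f2) (integrableZl mD (Im c) f1).
  by apply: eq_integrable => // x _ /=; rewrite -!EFinM -EFinD -ImM.
Qed.

Lemma cintegralZ (c : R[i]) f : cintegrable m D f ->
  cintegral m D (fun x => c * f x) = c * cintegral m D f.
Proof.
move=> [f1 f2].
have Z (r : R) (h : T -> R) : m.-integrable D (EFin \o h) ->
    m.-integrable D (EFin \o (fun x => r * h x)).
  move=> ih; have := integrableZl mD r ih.
  by apply: eq_integrable => // x _ /=; rewrite EFinM.
rewrite /cintegral.
under eq_Rintegral do rewrite ReM.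
under [X in _ +i* X]eq_Rintegral do rewrite ImM.
rewrite RintegralB ?RintegralD ?RintegralZl//; try exact: Z.
by case: c {Z}.
Qed.

Lemma cintegral_sum (I : Type) (s : seq I) (F : I -> T -> R[i]) :
  (forall i, cintegrable m D (F i)) ->
  cintegral m D (fun x => \sum_(i <- s) F i x) = \sum_(i <- s) cintegral m D (F i).
Proof.
move=> iF; elim: s => [|i s IH].
  by rewrite big_nil; under eq_fun do rewrite big_nil; exact: cintegral0.
have iS : cintegrable m D (fun x => \sum_(j <- s) F j x).
  elim: s {IH} => [|j s IH].
    by under eq_fun do rewrite big_nil; exact: cintegrable0.
  by under eq_fun do rewrite big_cons; exact: cintegrableD.
by rewrite big_cons -IH -cintegralD//; congr cintegral; apply/funext => x; rewrite big_cons.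
Qed.

Hypothesis fin_D : (m D < +oo)%E.

Lemma le_cst_integrable (h : T -> R) (M : R) : measurable_fun D h ->
  (forall x, D x -> `|h x| <= M) -> m.-integrable D (EFin \o h).
Proof.
move=> mh hM; apply: measurable_bounded_integrable => //.
by exists M; split=> [|N MN x Dx /=]; [exact: num_real|exact: le_trans (hM _ Dx) (ltW MN)].
Qed.

Lemma le_cst_cintegrable f (M : R) : cmeasurable D f ->
  (forall x, D x -> normc (f x) <= M) -> cintegrable m D f.
Proof.
move=> [f1 f2] fM; split; apply: (@le_cst_integrable _ M) => // x /fM; apply: le_trans.
- exact: le_Re_normc.
- exact: le_Im_normc.
Qed.

Lemma ae_eq_cintegral f g : cmeasurable D f -> cmeasurable D g ->
  ae_eq m D f g -> cintegral m D f = cintegral m D g.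
Proof.
move=> [f1 f2] [g1 g2] fg; rewrite /cintegral /Rintegral.
congr (fine _ +i* fine _); apply: ae_eq_integral => //.
- by move/measurable_EFinP : f1.
- by move/measurable_EFinP : g1.
- exact: (ae_eq_comp (EFin \o Re) fg).
- by move/measurable_EFinP : f2.
- by move/measurable_EFinP : g2.
- exact: (ae_eq_comp (EFin \o Im) fg).
Qed.

End ComplexIntegral.

(** * Characters of the circle *)

(** By the addition formulas, the real and imaginary parts of a character of the
    torus are sums of such products, so that Fubini reduces their integrals to the
    circle. *)
Lemma Rintegral_prod d1 d2 (T1 : measurableType d1) (T2 : measurableType d2)
    (R : realType) (m1 : {sigma_finite_measure set T1 -> \bar R})
    (m2 : {sigma_finite_measure set T2 -> \bar R})
    (A : set T1) (B : set T2) (g : T1 -> R) (h : T2 -> R) :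
  measurable A -> measurable B ->
  m1.-integrable A (EFin \o g) -> m2.-integrable B (EFin \o h) ->
  (m1 \x m2)%E.-integrable (A `*` B) (fun x => (g x.1 * h x.2)%:E) ->
  \int[(m1 \x m2)%E]_(x in A `*` B) (g x.1 * h x.2) =
  \int[m1]_(x in A) g x * \int[m2]_(y in B) h y.
Proof.
move=> mA mB ig ih igh.
have E : (fun x => g x.1 * h x.2) \_ (A `*` B) =
    (fun x : T1 * T2 => (g \_ A) x.1 * (h \_ B) x.2).
  apply/funext => -[x y]; rewrite !patchE /= in_setX /=.
  by case: (x \in A); case: (y \in B); rewrite ?mul0r ?mulr0.
rewrite Rintegral_mkcond E.
have i2 : (m1 \x m2)%E.-integrable setT (fun x => ((g \_ A) x.1 * (h \_ B) x.2)%:E).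
  have := (integrable_mkcond _ (measurableX mA mB)).1 igh.
  apply: eq_integrable => // x _.
  have /(congr1 (fun f => (f x)%:E)) /= <- := E.
  by rewrite !patchE; case: ifP.
have igA : m1.-integrable setT (EFin \o (g \_ A)).
  have := (integrable_mkcond _ mA).1 ig; apply: eq_integrable => // x _ /=.
  by rewrite !patchE; case: ifP.
have ihB : m2.-integrable setT (EFin \o (h \_ B)).
  have := (integrable_mkcond _ mB).1 ih; apply: eq_integrable => // y _ /=.
  by rewrite !patchE; case: ifP.
rewrite {1}/Rintegral -(integral12_prod_meas1 i2).
have -> : \int[m1]_(x in A) g x * \int[m2]_(y in B) h y =
    \int[m1]_x ((g \_ A) x * \int[m2]_y (h \_ B) y).
  by rewrite RintegralZr// -!Rintegral_mkcond.
congr fine; apply: eq_integral => x _.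
rewrite /fubini_F EFinM /Rintegral fineK; last exact: integrable_fin_num.
by rewrite -integralZl//; apply: eq_integral => y _; rewrite EFinM.
Qed.

Section Characters.
Local Open Scope complex_scope.
Context {R : realType}.
Local Notation mu := (@lebesgue_measure R).
Local Notation mu2 := (@lebesgue_measure R \x @lebesgue_measure R)%E.
Local Notation normc := (@Normc.normc R).
Local Notation circle := (`[0, 2 * pi]%classic : set R).

Lemma expi0 : expi 0 = 1 :> R[i].
Proof. by rewrite /expi cos0 sin0. Qed.

Lemma expiD (a b : R) : expi (a + b) = expi a * expi b.
Proof.
apply/eqP; rewrite eq_complex ReM ImM /= cosD sinD eqxx/=.
by apply/eqP; ring.
Qed.

Lemma conjc_expi (a : R) : conjc (expi a) = expi (- a).
Proof. by rewrite /expi /= cosN sinN. Qed.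

Lemma normc_expi (a : R) : normc (expi a) = 1.
Proof. by rewrite /= cos2Dsin2 sqrtr1. Qed.

Lemma expi_2piz (k : int) : expi (k%:~R * (2 * pi)) = 1 :> R[i].
Proof.
have E (n : nat) : expi (n%:R * (2 * pi)) = 1 :> R[i].
  elim: n => [|n IH]; first by rewrite mul0r expi0.
  rewrite -natr1 mulrDl expiD IH mul1r mul1r.
  by rewrite /expi mulr_natl cos2pi sin2pi.
case: k => n; first by rewrite -pmulrn E.
by rewrite NegzE mulrNz mulNr -conjc_expi -pmulrn E conjc1.
Qed.

Lemma measurable_circle : measurable circle. Proof. exact: measurable_itv. Qed.

Lemma mu_circle : mu circle = (2 * pi)%:E.
Proof.
by rewrite lebesgue_measure_itv /= lte_fin mulr_gt0 ?pi_gt0// EFinN sube0.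
Qed.

Let pi2_gt0 : 0 < 2 * pi :> R. Proof. by rewrite mulr_gt0 ?pi_gt0. Qed.

Lemma Rintegral_cos_circle (k : int) :
  \int[mu]_(x in circle) cos (k%:~R * x) = if k == 0 then 2 * pi else 0.
Proof.
have [->|k0] := eqVneq k 0.
  under eq_Rintegral do rewrite mul0r cos0.
  rewrite /Rintegral integral_cst; last exact: measurable_circle.
  by rewrite mul1e [X in fine X]mu_circle.
have kR : k%:~R != 0 :> R by rewrite intr_eq0.
pose F (x : R) : R := (k%:~R)^-1 * sin (k%:~R * x).
have dF (x : R) : is_derive x 1 F (cos (k%:~R * x)).
  rewrite /F; apply: is_derive_eq.
  by rewrite /GRing.scale/=; field.
have cF : continuous F.
  by move=> x; apply: differentiable_continuous; apply/derivable1_diffP; exact: ex_derive.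
rewrite /Rintegral (@continuous_FTC2 _ _ F)//.
- have := expi_2piz k; rewrite /expi => -[_ s].
  by rewrite /F s mulr0 mulr0 sin0 mulr0 subee.
- apply: continuous_subspaceT => x; apply: continuous_comp; last exact: continuous_cos.
  exact: mulrl_continuous.
- split; first by move=> x _; exact: ex_derive.
  + exact/cvg_at_right_filter/cF.
  + exact/cvg_at_left_filter/cF.
- by move=> x _; rewrite derive1E derive_val.
Qed.

Lemma Rintegral_sin_circle (k : int) : \int[mu]_(x in circle) sin (k%:~R * x) = 0.
Proof.
have [->|k0] := eqVneq k 0.
  under eq_Rintegral do rewrite mul0r sin0.
  by rewrite /Rintegral integral0.
have kR : k%:~R != 0 :> R by rewrite intr_eq0.
pose F (x : R) : R := - (k%:~R)^-1 * cos (k%:~R * x).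
have dF (x : R) : is_derive x 1 F (sin (k%:~R * x)).
  rewrite /F; apply: is_derive_eq.
  by rewrite /GRing.scale/=; field.
have cF : continuous F.
  by move=> x; apply: differentiable_continuous; apply/derivable1_diffP; exact: ex_derive.
rewrite /Rintegral (@continuous_FTC2 _ _ F)//.
- have := expi_2piz k; rewrite /expi => -[c _].
  by rewrite /F c mulr0 cos0 subee.
- apply: continuous_subspaceT => x; apply: continuous_comp; last exact: continuous_sin.
  exact: mulrl_continuous.
- split; first by move=> x _; exact: ex_derive.
  + exact/cvg_at_right_filter/cF.
  + exact/cvg_at_left_filter/cF.
- by move=> x _; rewrite derive1E derive_val.
Qed.

Lemma measurable_square : measurable (@square R).
Proof. by apply: measurableX; exact: measurable_circle. Qed.

Lemma mu2_square : mu2 (@square R) = (4 * pi ^+ 2)%:E.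
Proof.
rewrite /square product_measure1E; [|exact: measurable_circle|exact: measurable_circle].
rewrite [X in (X * _)%E]mu_circle [X in (_ * X)%E]mu_circle -EFinM.
by congr (_%:E); rewrite mulrACA -natrM expr2.
Qed.

Lemma mu2_square_lty : (mu2 (@square R) < +oo)%E.
Proof. by rewrite [X in (X < _)%E]mu2_square ltry. Qed.

End Characters.

(** * Trigonometric polynomials on the torus *)

Section TrigonometricPolynomials.
Local Open Scope complex_scope.
Context {R : realType}.
Local Notation mu := (@lebesgue_measure R).
Local Notation mu2 := (@lebesgue_measure R \x @lebesgue_measure R)%E.
Local Notation normc := (@Normc.normc R).
Local Notation circle := (`[0, 2 * pi]%classic : set R).

Lemma dotD (k l : int * int) (x : R * R) : dot (k + l) x = dot k x + dot l x.
Proof. by rewrite /dot /= !rmorphD/=; ring. Qed.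

Lemma dotN (k : int * int) (x : R * R) : dot (- k) x = - dot k x.
Proof. by rewrite /dot /= !rmorphN/=; ring. Qed.

Lemma measurable_dot (k : int * int) (D : set (R * R)) : measurable_fun D (dot k).
Proof.
have H : measurable_fun [set: R * R] (dot k).
  apply: measurable_funD; apply: measurable_funM.
  - exact: measurable_cst.
  - exact: measurable_fst.
  - exact: measurable_cst.
  - exact: measurable_snd.
exact: measurable_funTS.
Qed.

Lemma expi_dot_periodic (k : int * int) : Defs.periodic (fun x : R * R => expi (dot k x)).
Proof.
move=> x; rewrite /dot; split.
- by rewrite [k.1%:~R * _]mulrDr addrAC expiD expi_2piz mulr1.
- by rewrite [k.2%:~R * _]mulrDr addrA expiD expi_2piz mulr1.
Qed.

Lemma integrable_square (h : R * R -> R) (M : R) : measurable_fun (@square R) h ->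
  (forall x, square x -> `|h x| <= M) -> mu2.-integrable square (EFin \o h).
Proof.
move=> mh hM.
apply: le_cst_integrable; last exact: hM.
- exact: measurable_square.
- exact: mu2_square_lty.
- exact: mh.
Qed.

Lemma cintegrable_square (f : R * R -> R[i]) (M : R) : cmeasurable square f ->
  (forall x, square x -> normc (f x) <= M) -> cintegrable mu2 square f.
Proof.
move=> mf fM.
apply: le_cst_cintegrable; last exact: fM.
- exact: measurable_square.
- exact: mu2_square_lty.
- exact: mf.
Qed.

Lemma Rintegral_square_prod (g h : R -> R) : measurable_fun setT g -> measurable_fun setT h ->
  (forall x, `|g x| <= 1) -> (forall x, `|h x| <= 1) ->
  mu2.-integrable square (fun x => (g x.1 * h x.2)%:E) /\
  \int[mu2]_(x in square) (g x.1 * h x.2) =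
  \int[mu]_(x in circle) g x * \int[mu]_(y in circle) h y.
Proof.
move=> mg mh g1 h1.
have i2 : mu2.-integrable square (fun x => (g x.1 * h x.2)%:E).
  apply: (@integrable_square (fun x => g x.1 * h x.2) 1).
    apply: measurable_funTS; apply: measurable_funM.
    - exact: measurableT_comp mg measurable_fst.
    - exact: measurableT_comp mh measurable_snd.
  by move=> x _; rewrite normrM mulr_ile1.
have i1 (f : R -> R) : measurable_fun setT f -> (forall x, `|f x| <= 1) ->
    mu.-integrable circle (EFin \o f).
  move=> mf f1; apply: le_cst_integrable; last by move=> x _; exact: f1.
  - exact: measurable_circle.
  - by rewrite [X in (X < _)%E]mu_circle ltry.
  - exact: measurable_funTS.
split=> //; apply: Rintegral_prod; [| |exact: i1|exact: i1|exact: i2].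
- exact: measurable_circle.
- exact: measurable_circle.
Qed.

Lemma cmeasurable_expi_dot (k : int * int) (D : set (R * R)) :
  cmeasurable D (fun x : R * R => expi (dot k x)).
Proof. by apply: cmeasurable_expi; exact: measurable_dot. Qed.

Lemma cintegrable_expi_dot (k : int * int) :
  cintegrable mu2 square (fun x : R * R => expi (dot k x)).
Proof.
apply: (@cintegrable_square _ 1); first exact: cmeasurable_expi_dot.
by move=> x _; rewrite normc_expi.
Qed.

Let measurable_sin_int (k : int) : measurable_fun setT (fun x : R => sin (k%:~R * x)).
Proof.
apply: continuous_measurable_fun => x; apply: continuous_comp; last exact: continuous_sin.
exact: mulrl_continuous.
Qed.

Let measurable_cos_int (k : int) : measurable_fun setT (fun x : R => cos (k%:~R * x)).
Proof.
apply: continuous_measurable_fun => x; apply: continuous_comp; last exact: continuous_cos.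
exact: mulrl_continuous.
Qed.

Let cos1 (x : R) : `|cos x| <= 1. Proof. by rewrite ler_norml cos_geN1 cos_le1. Qed.
Let sin1 (x : R) : `|sin x| <= 1. Proof. by rewrite ler_norml sin_geN1 sin_le1. Qed.

(** Orthogonality of characters: in each coordinate the antiderivative of a
    nonconstant character is periodic. *)
Lemma cintegral_expi_dot (k : int * int) :
  cintegral mu2 square (fun x : R * R => expi (dot k x)) =
  if k == 0 then (4 * pi ^+ 2)%:C else 0.
Proof.
rewrite /cintegral /=.
under eq_Rintegral do rewrite /dot cosD.
under [X in _ +i* X]eq_Rintegral do rewrite /dot sinD.
have [i1 e1] := Rintegral_square_prod (measurable_cos_int k.1) (measurable_cos_int k.2)
  (fun x => cos1 _) (fun x => cos1 _).
have [i2 e2] := Rintegral_square_prod (measurable_sin_int k.1) (measurable_sin_int k.2)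
  (fun x => sin1 _) (fun x => sin1 _).
have [i3 e3] := Rintegral_square_prod (measurable_sin_int k.1) (measurable_cos_int k.2)
  (fun x => sin1 _) (fun x => cos1 _).
have [i4 e4] := Rintegral_square_prod (measurable_cos_int k.1) (measurable_sin_int k.2)
  (fun x => cos1 _) (fun x => sin1 _).
rewrite RintegralB ?RintegralD//; try exact: measurable_square.
rewrite e1 e2 e3 e4 !Rintegral_cos_circle !Rintegral_sin_circle.
rewrite !(mulr0, mul0r) addr0 subr0 complexr0.
case: k {i1 i2 i3 i4 e1 e2 e3 e4} => k1 k2; rewrite /= xpair_eqE.
have [_|] := eqVneq k1 0; have [_|] := eqVneq k2 0; rewrite ?mulr0 ?mul0r//=.
by congr (_%:C); ring.
Qed.

(** Coefficients and frequencies are indexed separately, so that a frequency may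
    occur several times: products of such sums are again of this form, and time
    evolution only affects the coefficients. *)
Definition trig (I : finType) (c : I -> R[i]) (k : I -> int * int) (x : R * R) : R[i] :=
  \sum_i c i * expi (dot (k i) x).

Section Trig.
Context (I : finType) (c : I -> R[i]) (k : I -> int * int).

Lemma trig_periodic : Defs.periodic (trig c k).
Proof.
by move=> x; split; apply: eq_bigr => i _; have [h1 h2] := expi_dot_periodic (k i) x;
  rewrite ?h1 ?h2.
Qed.

Lemma cmeasurable_trig (D : set (R * R)) : cmeasurable D (trig c k).
Proof.
apply: cmeasurable_sum => i; apply: cmeasurableM; first exact: cmeasurable_cst.
exact: cmeasurable_expi_dot.
Qed.

Lemma normc_trig_le x : normc (trig c k x) <= \sum_i normc (c i).
Proof.
apply: le_trans (le_normc_sum _ _) _; apply: ler_sum => i _.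
by rewrite Normc.normcM normc_expi mulr1.
Qed.

Lemma L1T2_trig : L1T2 (trig c k).
Proof.
split; [exact: trig_periodic|exact: cmeasurable_trig|].
apply: (@integrable_square (normc \o trig c k) (\sum_i normc (c i))).
  exact/measurable_normc/cmeasurable_trig.
by move=> x _; rewrite ger0_norm ?normc_ge0// normc_trig_le.
Qed.

Lemma L2T2_trig : L2T2 (trig c k).
Proof.
split; [exact: trig_periodic|exact: cmeasurable_trig|].
apply: (@integrable_square (fun x => normc (trig c k x) ^+ 2) ((\sum_i normc (c i)) ^+ 2)).
  exact/measurable_normc2/cmeasurable_trig.
move=> x _; rewrite ger0_norm ?sqr_ge0// ler_pXn2r ?normc_trig_le// nnegrE ?normc_ge0//.
by apply: sumr_ge0 => i _; exact: normc_ge0.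
Qed.

Lemma cintegral_trig :
  cintegral mu2 square (trig c k) = (4 * pi ^+ 2)%:C * \sum_(i | k i == 0) c i.
Proof.
have -> : cintegral mu2 square (trig c k) =
    \sum_i cintegral mu2 square (fun x => c i * expi (dot (k i) x)).
  apply: cintegral_sum => [|i]; first exact: measurable_square.
  by apply: cintegrableZ; [exact: measurable_square|exact: cintegrable_expi_dot].
rewrite mulr_sumr [RHS]big_mkcond; apply: eq_bigr => i _.
have -> : cintegral mu2 square (fun x => c i * expi (dot (k i) x)) =
    c i * cintegral mu2 square (fun x : R * R => expi (dot (k i) x)).
  by apply: cintegralZ; [exact: measurable_square|exact: cintegrable_expi_dot].
by rewrite cintegral_expi_dot; case: ifP; rewrite ?mulr0// mulrC.
Qed.

End Trig.

Lemma mul_expi_trig (I : finType) (c : I -> R[i]) (k : I -> int * int) (l : int * int) x :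
  expi (- dot l x) * trig c k x = trig c (fun i => k i - l) x.
Proof.
rewrite /trig mulr_sumr; apply: eq_bigr => i _.
by rewrite dotD dotN expiD mulrCA [expi (- _) * _]mulrC.
Qed.

(** Multiplying by a character only translates the frequencies, so that every
    Fourier coefficient is a mean value. Several indices may share a frequency, hence
    the sum. *)
Lemma fourier_trig (I : finType) (c : I -> R[i]) (k : I -> int * int) (l : int * int) :
  fourier (trig c k) l = \sum_(i | k i == l) c i.
Proof.
rewrite /fourier; under eq_fun do rewrite mul_expi_trig.
rewrite cintegral_trig mulrA -rmorphM/= mulVf ?rmorph1 ?mul1r.
  by apply: eq_bigl => i; rewrite subr_eq0.
by rewrite mulf_neq0 ?expf_neq0// gt_eqF// pi_gt0.
Qed.

End TrigonometricPolynomials.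

(** * Synthesis of a finite Fourier series *)

Section Synthesis.
Local Open Scope complex_scope.
Context {R : realType}.
Local Notation mu2 := (@lebesgue_measure R \x @lebesgue_measure R)%E.
Local Notation normc := (@Normc.normc R).

(** The square of frequencies summed over in [partial_sum] is indexed from [0], with
    an offset of [N]; a frequency in it is met exactly once. *)
Lemma sum_square_delta (kappa : int * int) (N : nat) (z : R[i]) :
  (`|kappa.1| <= N)%N -> (`|kappa.2| <= N)%N ->
  \sum_(i < N.*2.+1) \sum_(j < N.*2.+1)
    (if kappa == (i%:Z - N%:Z, j%:Z - N%:Z) then z else 0) = z.
Proof.
case: kappa => k1 k2 /= h1 h2.
have box (a : int) : (`|a| <= N)%N -> exists i : 'I_N.*2.+1, a = i%:Z - N%:Z.
  move=> ha; have h : (`|(a + N%:Z)%R| < N.*2.+1)%N by lia.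
  by exists (Ordinal h) => /=; lia.
have [i0 ->] := box _ h1; have [j0 ->] := box _ h2.
have E (i j : 'I_N.*2.+1) :
    ((i0%:Z - N%:Z, j0%:Z - N%:Z) == (i%:Z - N%:Z, j%:Z - N%:Z)) = (i == i0) && (j == j0).
  by rewrite xpair_eqE !(inj_eq (addIr _)) !eqz_nat (eq_sym i) (eq_sym j).
rewrite (bigD1 i0)//= (bigD1 j0)//= E !eqxx big1 ?big1 ?addr0//.
- by move=> i ni; rewrite big1// => j _; rewrite E (negbTE ni).
- by move=> j nj; rewrite E (negbTE nj) andbF.
Qed.

Lemma partial_sum_trig (I : finType) (c : I -> R[i]) (k : I -> int * int) (N : nat) x :
  (forall i, (`|(k i).1| <= N)%N /\ (`|(k i).2| <= N)%N) ->
  partial_sum (fun l => \sum_(i | k i == l) c i) N x = trig c k x.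
Proof.
move=> kN; rewrite /partial_sum /trig.
transitivity (\sum_(i < N.*2.+1) \sum_(j < N.*2.+1) \sum_a
    if k a == (i%:Z - N%:Z, j%:Z - N%:Z) then c a * expi (dot (k a) x) else 0).
  apply: eq_bigr => i _; apply: eq_bigr => j _; rewrite /= mulr_suml big_mkcond/=.
  by apply: eq_bigr => a _; case: eqVneq => // ->.
under eq_bigr do rewrite exchange_big/=.
rewrite exchange_big/=; apply: eq_bigr => a _.
by apply: sum_square_delta; have [] := kN a.
Qed.

Lemma near_partial_sum_trig (I : finType) (c : I -> R[i]) (k : I -> int * int) :
  \forall N \near \oo,
    partial_sum (fun l => \sum_(i | k i == l) c i) N = trig c k.
Proof.
near=> N; apply/funext => x; apply: partial_sum_trig => i.
have N0 : (\max_j (`|(k j).1| + `|(k j).2|) <= N)%N by near: N; exact: nbhs_infty_ge.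
have /= := leq_trans (leq_bigmax (F := fun j => (`|(k j).1| + `|(k j).2|)%N) i) N0.
by lia.
Unshelve. all: by end_near. Qed.

(** The partial sums of a finite Fourier series are eventually stationary, so the
    limit in quadratic mean is the trigonometric polynomial itself; the choice made
    by [synthesis] can only differ from it on a null set. *)
Lemma synthesis_trig (I : finType) (c : I -> R[i]) (k : I -> int * int) :
  let g := synthesis (fun l => \sum_(i | k i == l) c i) in
  L2T2 g /\ ae_eq mu2 square g (trig c k).
Proof.
set P := [set g | L2T2 g /\ (fun N => \int[mu2]_(x in square)
  (normc (g x - partial_sum (fun l => \sum_(i | k i == l) c i) N x) ^+ 2)%:E)%E
    @ \oo --> (0 : \bar R)%E].
have near_cst (g : R * R -> R[i]) : \forall N \near \oo,
    (\int[mu2]_(x in square) (normc (g x - trig c k x) ^+ 2)%:E)%E =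
    (\int[mu2]_(x in square)
      (normc (g x - partial_sum (fun l => \sum_(i | k i == l) c i) N x) ^+ 2)%:E)%E.
  by apply: filterS (near_partial_sum_trig c k) => N ->.
have Ptrig : P (trig c k).
  split; first exact: L2T2_trig.
  apply: cvg_near_cst; apply: filterS (near_cst (trig c k)) => N <-.
  by under eq_integral do rewrite subrr Normc.normc0 expr0n; rewrite integral0.
have [L2g] : P (synthesis (fun l => \sum_(i | k i == l) c i)).
  exact: (xgetPex _ (ex_intro _ _ Ptrig)).
set g := synthesis _ => cvg0; split => //.
have I0 : (\int[mu2]_(x in square) (normc (g x - trig c k x) ^+ 2)%:E = 0)%E.
  apply: (cvg_unique _ _ cvg0) => //.
  by apply: cvg_near_cst; apply: filterS (near_cst g) => N ->.
have [_ mg _] := L2g.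
have mN : measurable_fun square (fun x => (normc (g x - trig c k x) ^+ 2)%:E).
  apply/measurable_EFinP/measurable_normc2/cmeasurableD => //.
  under eq_fun do rewrite -mulN1r; apply: cmeasurableM; first exact: cmeasurable_cst.
  exact: cmeasurable_trig.
have : ae_eq mu2 square (fun x => (normc (g x - trig c k x) ^+ 2)%:E) (cst 0%E).
  apply/ae_eq_integral_abs; [exact: measurable_square|exact: mN|rewrite -[RHS]I0].
  by apply: eq_integral => x _; rewrite gee0_abs// lee_fin sqr_ge0.
apply: filterS => x /[apply] /= -[] /eqP.
by rewrite sqrf_eq0 => /eqP/Normc.eq0_normc/eqP; rewrite subr_eq0 => /eqP.
Qed.

End Synthesis.

(** * The renormalised cubic term of a trigonometric polynomial *)

Section AlmostEverywhere.
Local Open Scope complex_scope.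
Context {R : realType}.
Local Notation mu2 := (@lebesgue_measure R \x @lebesgue_measure R)%E.
Local Notation normc := (@Normc.normc R).

Implicit Types f g : R * R -> R[i].

Lemma ae_eq_Rintegral_square (h1 h2 : R * R -> R) :
  measurable_fun square h1 -> measurable_fun square h2 ->
  ae_eq mu2 square h1 h2 ->
  (\int[mu2]_(x in square) (h1 x)%:E = \int[mu2]_(x in square) (h2 x)%:E)%E.
Proof.
move=> m1 m2 h12; apply: ae_eq_integral; first exact: measurable_square.
- by move/measurable_EFinP : m1.
- by move/measurable_EFinP : m2.
- exact: (ae_eq_comp EFin h12).
Qed.

Lemma ae_eq_normL2 f g : cmeasurable square f -> cmeasurable square g ->
  ae_eq mu2 square f g -> normL2 f = normL2 g.
Proof.
move=> mf mg fg; congr (Num.sqrt (fine _)); apply: ae_eq_Rintegral_square.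
- exact: measurable_normc2.
- exact: measurable_normc2.
- exact: (ae_eq_comp (fun z => normc z ^+ 2) fg).
Qed.

Lemma ae_eq_normL1 f g : cmeasurable square f -> cmeasurable square g ->
  ae_eq mu2 square f g -> normL1 f = normL1 g.
Proof.
move=> mf mg fg; congr fine; apply: ae_eq_Rintegral_square.
- exact: measurable_normc.
- exact: measurable_normc.
- exact: (ae_eq_comp normc fg).
Qed.

Lemma ae_eq_fourier f g : cmeasurable square f -> cmeasurable square g ->
  ae_eq mu2 square f g -> fourier f = fourier g.
Proof.
move=> mf mg fg; apply/funext => l; congr (_ * _).
apply: ae_eq_cintegral; first exact: measurable_square.
- by apply: cmeasurableM => //; under eq_fun do rewrite -dotN; exact: cmeasurable_expi_dot.
- by apply: cmeasurableM => //; under eq_fun do rewrite -dotN; exact: cmeasurable_expi_dot.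
- by move: fg; apply: filterS => x /[apply] ->.
Qed.

Lemma ae_eq_L1T2 f g : Defs.periodic f -> cmeasurable square f ->
  ae_eq mu2 square f g -> L1T2 g -> L1T2 f.
Proof.
move=> pf mf fg [_ mg /integrableP[_ ig]]; split=> //; apply/integrableP; split.
  by have /measurable_EFinP := measurable_normc mf.
move: ig; congr (_ < _)%E; apply: ae_eq_integral; first exact: measurable_square.
- by apply/measurableT_comp => //; have /measurable_EFinP := measurable_normc mg.
- by apply/measurableT_comp => //; have /measurable_EFinP := measurable_normc mf.
- apply: ae_eq_sym; exact: (ae_eq_comp (fun z => `|(normc z)%:E|%E) fg).
Qed.

Lemma cmeasurable_wick_cubic f : cmeasurable square f ->
  cmeasurable square (wick_cubic f).
Proof.
move=> mf; rewrite /wick_cubic.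
under eq_fun do rewrite sqr_normc -mulNr.
apply: cmeasurableD; apply: cmeasurableM => //.
by apply: cmeasurableM => //; exact: cmeasurable_conj.
Qed.

Lemma periodic_wick_cubic f : Defs.periodic f -> Defs.periodic (wick_cubic f).
Proof. by move=> pf x; rewrite /wick_cubic; have [-> ->] := pf x. Qed.

Lemma ae_eq_wick_cubic f g : cmeasurable square f -> cmeasurable square g ->
  ae_eq mu2 square f g -> ae_eq mu2 square (wick_cubic f) (wick_cubic g).
Proof.
move=> mf mg fg; rewrite /wick_cubic (ae_eq_normL2 mf mg fg).
exact: (ae_eq_comp (fun z => `|z| ^+ 2 * z - (normL2 g ^+ 2 / (2 * pi ^+ 2))%:C * z) fg).
Qed.

End AlmostEverywhere.

Section WickCubic.
Local Open Scope complex_scope.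
Context {R : realType}.
Local Notation normc := (@Normc.normc R).
Local Notation Re := (@complex.Re R).
Context (I : finType).
Implicit Types (c : I -> R[i]) (k : I -> int * int).

(** The left summand indexes the triples of the cubic product, the right one the terms
    removed by the renormalisation; [m] stands for twice the sum of the squared moduli
    of the coefficients. *)
Definition wick_coef (m : R[i]) c (a : I * I * I + I) : R[i] :=
  match a with
  | inl (p, q, r) => c p * conjc (c q) * c r
  | inr i => - m * c i
  end.

Definition wick_freq k (a : I * I * I + I) : int * int :=
  match a with
  | inl (p, q, r) => k p - k q + k r
  | inr i => k i
  end.

Lemma trig_conj c k (x : R * R) :
  conjc (trig c k x) = trig (fun i => conjc (c i)) (fun i => - k i) x.
Proof.
rewrite /trig rmorph_sum; apply: eq_bigr => i _.
by rewrite (rmorphM conjc) [X in _ * X]conjc_expi dotN.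
Qed.

Lemma trigM (J K : finType) (c : J -> R[i]) (k : J -> int * int)
    (c' : K -> R[i]) (k' : K -> int * int) (x : R * R) :
  trig c k x * trig c' k' x =
  trig (fun a : J * K => c a.1 * c' a.2) (fun a => k a.1 + k' a.2) x.
Proof.
rewrite /trig mulr_suml.
under eq_bigr do rewrite mulr_sumr.
rewrite pair_bigA; apply: eq_bigr => -[p q] _.
by rewrite [_.1]/= [_.2]/= dotD expiD; ring.
Qed.

(** Parseval: with distinct frequencies, only the diagonal terms of the square have
    mean value different from zero. *)
Lemma normL2_trig c k : injective k ->
  normL2 (trig c k) ^+ 2 = 4 * pi ^+ 2 * \sum_i normc (c i) ^+ 2.
Proof.
move=> kI; rewrite /normL2 sqr_sqrtr; last by apply: Rintegral_ge0 => x _; exact: sqr_ge0.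
have E : (fun x : R * R => normc (trig c k x) ^+ 2) = (fun x => Re
    (trig (fun a : I * I => c a.1 * conjc (c a.2)) (fun a => k a.1 - k a.2) x)).
  apply/funext => x; rewrite -(trigM c k (fun i => conjc (c i)) (fun i => - k i)) -trig_conj.
  by rewrite normcE2; case: (trig c k x) => a b /=; ring.
rewrite E.
have := cintegral_trig (fun a : I * I => c a.1 * conjc (c a.2)) (fun a => k a.1 - k a.2).
move/(congr1 Re) => /= ->; rewrite ReM /= mul0r subr0; congr (_ * _).
have -> : \sum_(a | k a.1 - k a.2 == 0) c a.1 * conjc (c a.2) = (\sum_i normc (c i) ^+ 2)%:C.
  rewrite big_mkcond.
  rewrite -(pair_bigA _ (fun p q => if k p - k q == 0 then c p * conjc (c q) else 0))/=.
  rewrite rmorph_sum; apply: eq_bigr => p _ /=.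
  rewrite (bigD1 p)//= subrr eqxx big1 ?addr0.
    by rewrite -sqr_normc -add_Re2_Im2 normcE2.
  move=> q qp; rewrite subr_eq0 (inj_eq kI) eq_sym (negbTE qp)//.
by [].
Qed.

Lemma wick_cubicE (v : R * R -> R[i]) x : wick_cubic v x =
  v x * conjc (v x) * v x - (normL2 v ^+ 2 / (2 * pi ^+ 2))%:C * v x.
Proof. by rewrite /wick_cubic sqr_normc. Qed.

Lemma wick_cubic_trig c k : injective k ->
  wick_cubic (trig c k) =
  trig (wick_coef (2 * \sum_i normc (c i) ^+ 2)%:C c) (wick_freq k).
Proof.
move=> kI; apply/funext => x; rewrite wick_cubicE normL2_trig//.
have -> : 4 * pi ^+ 2 * (\sum_i normc (c i) ^+ 2) / (2 * pi ^+ 2) =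
    2 * \sum_i normc (c i) ^+ 2 :> R.
  have pi0 : pi != 0 :> R by rewrite gt_eqF// pi_gt0.
  by move: pi0; move: (pi : R) => y y0; field; exact: y0.
rewrite [RHS]/trig big_sumType/=; congr (_ + _).
- rewrite trig_conj 2!trigM /trig; apply: eq_bigr => -[[p q] r] _ //=.
- by rewrite -mulNr /trig mulr_sumr; apply: eq_bigr => i _; rewrite mulrA.
Qed.

End WickCubic.

(** * Free evolution and integrability in time *)

(** Tonelli's theorem, applied once for each factor of the product measure. *)
Lemma measurable_fun_Rintegral_section d d1 d2 (S : measurableType d)
    (T1 : measurableType d1) (T2 : measurableType d2) (R : realType)
    (m1 : {sigma_finite_measure set T1 -> \bar R})
    (m2 : {sigma_finite_measure set T2 -> \bar R})
    (D : set (T1 * T2)) (f : S -> T1 * T2 -> R) :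
  measurable D -> measurable_fun setT (fun z : S * (T1 * T2) => f z.1 z.2) ->
  (forall s x, 0 <= f s x) ->
  measurable_fun setT (fun s => \int[(m1 \x m2)%E]_(x in D) f s x).
Proof.
move=> mD mf f0.
pose F (z : S * (T1 * T2)) : \bar R := (f z.1 z.2 * \1_D z.2)%:E.
have mF : measurable_fun setT F.
  apply/measurable_EFinP; apply: measurable_funM => //.
  by apply: (measurableT_comp _ measurable_snd); exact: measurable_indic.
have F0 z : (0 <= F z)%E by rewrite lee_fin mulr_ge0.
pose H (z : S * T1 * T2) := F (z.1.1, (z.1.2, z.2)).
have mH : measurable_fun setT H.
  apply: measurableT_comp mF _; apply: measurable_fun_pair => /=.
    exact: measurableT_comp measurable_fst measurable_fst.
  apply: measurable_fun_pair; last exact: measurable_snd.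
  exact: measurableT_comp measurable_snd measurable_fst.
have mG := measurable_fun_fubini_tonelli_F (m2 := m2) _ mH (fun z => F0 _).
have G0 z : (0 <= fubini_F m2 H z)%E by apply: integral_ge0 => y _; exact: F0.
have mK := measurable_fun_fubini_tonelli_F (m2 := m1) _ mG G0.
have := measurableT_comp (@fine_measurable R setT measurableT) mK.
apply: eq_measurable_fun => s _ /=; congr fine.
have mFs : measurable_fun setT (fun x => F (s, x)).
  exact: measurableT_comp mF (pair1_measurable s).
have := fubini_tonelli1 (m1 := m1) (m2 := m2) _ mFs (fun x => F0 _).
rewrite /fubini_F /= => <-.
rewrite [RHS]integral_mkcond; apply: eq_integral => x _.
by rewrite patchE /F /= indicE; case: (x \in D); rewrite ?mulr1 ?mulr0.
Qed.

Section FreeEvolution.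
Local Open Scope complex_scope.
Context {R : realType}.
Local Notation mu := (@lebesgue_measure R).
Local Notation mu2 := (@lebesgue_measure R \x @lebesgue_measure R)%E.
Local Notation normc := (@Normc.normc R).
Context (I : finType) (c : I -> R[i]) (k : I -> int * int).

Definition free_coef (s : R) (i : I) : R[i] := expi (- (s * sqnorm (k i))) * c i.

Lemma normc_free_coef s i : normc (free_coef s i) = normc (c i).
Proof. by rewrite Normc.normcM normc_expi mul1r. Qed.

(** The Schroedinger group acts diagonally: it changes the coefficients and keeps the
    frequencies. *)
Lemma schrodinger_trig s : schrodinger s (fourier (trig c k)) =
  fun l => \sum_(i | k i == l) free_coef s i.
Proof.
apply/funext => l; rewrite /schrodinger fourier_trig mulr_sumr.
by apply: eq_bigr => i /eqP <-.
Qed.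

Lemma free_evolution_trig s : L2T2 (free_evolution (trig c k) s) /\
  ae_eq mu2 square (free_evolution (trig c k) s) (trig (free_coef s) k).
Proof. by rewrite /free_evolution schrodinger_trig; exact: synthesis_trig. Qed.

Hypothesis kI : injective k.

(** The free evolution preserves the mass, so the Wick counterterm does not depend
    on time. *)
Definition nonlinear_coef (s : R) : I * I * I + I -> R[i] :=
  wick_coef (2 * \sum_i normc (c i) ^+ 2)%:C (free_coef s).

Lemma ae_eq_wick_free s : ae_eq mu2 square
  (wick_cubic (free_evolution (trig c k) s)) (trig (nonlinear_coef s) (wick_freq k)).
Proof.
have [[_ mg _] g_eq] := free_evolution_trig s.
have := ae_eq_wick_cubic mg (cmeasurable_trig _ _ square) g_eq.
rewrite wick_cubic_trig// /nonlinear_coef.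
by under eq_bigr do rewrite normc_free_coef.
Qed.

Lemma cmeasurable_wick_free s :
  cmeasurable square (wick_cubic (free_evolution (trig c k) s)).
Proof. by have [[_ mg _] _] := free_evolution_trig s; exact: cmeasurable_wick_cubic. Qed.

Lemma L1T2_wick_free s : L1T2 (wick_cubic (free_evolution (trig c k) s)).
Proof.
apply: (ae_eq_L1T2 _ (cmeasurable_wick_free s) (ae_eq_wick_free s) (L1T2_trig _ _)).
by have [[pg _ _] _] := free_evolution_trig s; exact: periodic_wick_cubic.
Qed.

Lemma fourier_wick_free s l : fourier (wick_cubic (free_evolution (trig c k) s)) l =
  \sum_(a | wick_freq k a == l) nonlinear_coef s a.
Proof.
rewrite -fourier_trig.
by rewrite (ae_eq_fourier (cmeasurable_wick_free s) (cmeasurable_trig _ _ _)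
  (ae_eq_wick_free s)).
Qed.

Lemma cmeasurable_nonlinear_coef a : cmeasurable [set: R] (nonlinear_coef ^~ a).
Proof.
have mfree i : cmeasurable [set: R] (free_coef ^~ i).
  apply: cmeasurableM; last exact: cmeasurable_cst.
  apply: cmeasurable_expi; apply: measurableT_comp => //.
  exact: measurable_funM.
case: a => [[[p q] r]|i].
- apply: cmeasurableM => //; apply: cmeasurableM => //.
  exact: cmeasurable_conj.
- by apply: cmeasurableM => //; exact: cmeasurable_cst.
Qed.

(** Time enters only through phases, so the bound on the cubic term is uniform in
    time. *)
Lemma normc_nonlinear_coef s a : normc (nonlinear_coef s a) = normc (nonlinear_coef 0 a).
Proof.
have normcJ (z : R[i]) : normc (conjc z) = normc z by case: z => x y /=; rewrite sqrrN.
rewrite /nonlinear_coef.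
move: (free_coef s) (free_coef 0) (normc_free_coef s) (normc_free_coef 0) => u v hu hv.
by case: a => [[[p q] r]|i]; rewrite !Normc.normcM ?normcJ !hu !hv.
Qed.

Lemma measurable_normL1_wick_free :
  measurable_fun [set: R] (fun s => normL1 (wick_cubic (free_evolution (trig c k) s))).
Proof.
have -> : (fun s => normL1 (wick_cubic (free_evolution (trig c k) s))) =
    (fun s => normL1 (trig (nonlinear_coef s) (wick_freq k))).
  apply/funext => s.
  exact: (ae_eq_normL1 (cmeasurable_wick_free s) (cmeasurable_trig _ _ _) (ae_eq_wick_free s)).
apply: measurable_fun_Rintegral_section; first exact: measurable_square.
- apply: measurable_normc; apply: cmeasurable_sum => a; apply: cmeasurableM.
  + have [m1 m2] := cmeasurable_nonlinear_coef a.
    split; first exact: measurableT_comp m1 measurable_fst.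
    exact: measurableT_comp m2 measurable_fst.
  + apply: cmeasurable_expi.
    by apply: measurableT_comp; [exact: measurable_dot|exact: measurable_snd].
- by move=> s x; exact: normc_ge0.
Qed.

Lemma locally_integrable_wick_free :
  locally_integrable_L1 (fun s => wick_cubic (free_evolution (trig c k) s)).
Proof.
split.
- by apply: aeW => s; exact: L1T2_wick_free.
- move=> l.
  have -> : (fun s => fourier (wick_cubic (free_evolution (trig c k) s)) l) =
      (fun s => \sum_a if wick_freq k a == l then nonlinear_coef s a else 0).
    by apply/funext => s; rewrite fourier_wick_free big_mkcond.
  apply: cmeasurable_sum => a; case: (wick_freq k a == l); last exact: cmeasurable_cst.
  exact: cmeasurable_nonlinear_coef.
- move=> a b.
  pose M := \sum_a normc (nonlinear_coef 0 a).
  apply: (@le_cst_integrable _ _ _ _ _ _ _ _ (\int[mu2]_(x in square) M)).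
  + exact: measurable_itv.
  + have : (mu `[a, b] < +oo)%E.
      by rewrite lebesgue_measure_itv; case: ifP => // _; rewrite -EFinB ltry.
    exact.
  + by apply: measurable_funTS; exact: measurable_normL1_wick_free.
  + move=> s _.
    rewrite (ae_eq_normL1 (cmeasurable_wick_free s) (cmeasurable_trig _ _ _)
      (ae_eq_wick_free s)).
    have [_ _ i1] := L1T2_trig (nonlinear_coef s) (wick_freq k).
    rewrite ger0_norm; last by apply: Rintegral_ge0 => x _; exact: normc_ge0.
    apply: le_Rintegral; [exact: measurable_square|exact: i1| |].
      by apply: (@integrable_square _ (fun=> M) `|M|).
    move=> x _; apply: le_trans (normc_trig_le _ _ _) _.
    by apply: ler_sum => i _; rewrite normc_nonlinear_coef.
Qed.

End FreeEvolution.

(** * Sobolev norms and the resonant interaction *)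

Section SobolevNorm.
Local Open Scope complex_scope.
Context {R : realType}.
Local Notation normc := (@Normc.normc R).
Implicit Types (s : R) (a : int * int -> R[i]).

Definition sobolev_weight s (l : int * int) (z : R[i]) : R :=
  (1 + sqnorm l) `^ s * (2 * pi * normc z) ^+ 2.

Lemma sobolev_weight_ge0 s l z : 0 <= sobolev_weight s l z.
Proof. by rewrite mulr_ge0 ?powR_ge0 ?sqr_ge0. Qed.

(** Since the frequencies are distinct, the weight at any [l] is the sum over [i] of the
    weight of the [i]-th mode if its frequency is [l] and [0] otherwise; exchanging the
    sums leaves one point mass for each mode. *)
Lemma normH_trig s (I : finType) (c : I -> R[i]) (k : I -> int * int) : injective k ->
  normH s (fourier (trig c k)) = ((\sum_i sobolev_weight s (k i) (c i)) `^ 2^-1)%:E.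
Proof.
move=> kI; rewrite /normH -poweR_EFin; congr poweR.
pose g l i : \bar R := if l \in [set k i] then (sobolev_weight s (k i) (c i))%:E else 0%E.
transitivity (\esum_(l in [set: int * int]) (\sum_i g l i)%E).
  apply: eq_esum => l _; rewrite -/(sobolev_weight s l _) fourier_trig /g.
  have in1 i : (l \in [set k i]) = (k i == l) by rewrite eq_sym; apply/idP/eqP; rewrite inE.
  under [RHS]eq_bigr do rewrite in1.
  have [[i <-]|nl] := pselect (exists i, k i = l).
    rewrite (big_pred1 i); last by move=> j; rewrite /= (inj_eq kI).
    rewrite (bigD1 i)//= eqxx big1 ?adde0// => j ji.
    by rewrite (inj_eq kI) (negbTE ji).
  have kl i : (k i == l) = false by apply/negbTE/eqP => ki; apply: nl; exists i.
  rewrite (eq_bigl _ _ kl) big_pred0_eq.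
  rewrite big1 => [|i _].
    by rewrite /sobolev_weight Normc.normc0 mulr0 expr0n mulr0.
  by rewrite kl.
rewrite esum_sum; last first.
  by move=> l i _ _; rewrite /g; case: ifP => // _; rewrite lee_fin sobolev_weight_ge0.
rewrite -sumEFin; apply: eq_bigr => i _.
by rewrite /g -esum_mkcond esum_set1// lee_fin sobolev_weight_ge0.
Qed.

(** All terms of the sum defining the norm are nonnegative, so a single mode suffices
    to make it large. *)
Lemma normH_ge s a (l : int * int) (A : R) : 0 <= A ->
  A ^+ 2 <= sobolev_weight s l (a l) -> (A%:E <= normH s a)%E.
Proof.
move=> A0 hA.
have -> : A%:E = poweR (A ^+ 2)%:E 2^-1.
  by rewrite poweR_EFin -powR_mulrn// -powRrM mulfV// powRr1.
apply: gt0_ler_poweR; rewrite ?invr_ge0//.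
- by rewrite in_itv/= lee_fin sqr_ge0 leey.
- rewrite in_itv/= leey andbT; apply: esum_ge0 => i _.
  by rewrite lee_fin sobolev_weight_ge0.
- apply: esum_ge; exists [set l]; first by split => //; exact: finite_set1.
  by rewrite fsbig_set1 lee_fin.
Qed.

Lemma oriented_integral_cst (a b : R) (z : R[i]) :
  oriented_integral a b (fun=> z) = (b - a)%:C * z.
Proof.
have cI (x y : R) : x <= y ->
    cintegral (@lebesgue_measure R) `[x, y] (fun=> z) = (y - x)%:C * z.
  move=> xy; rewrite /cintegral !Rintegral_cst//.
  have -> : fine (lebesgue_measure (`[x, y]%classic : set R)) = y - x.
    rewrite lebesgue_measure_itv /= lte_fin.
    by case: ltgtP xy => // -> _; rewrite subrr.
  case: z => u v; apply/eqP; rewrite eq_complex ReM ImM /= !mul0r subr0 addr0.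
  by rewrite !(mulrC (y - x)) !eqxx.
rewrite /oriented_integral; case: leP => [/cI //|/ltW /cI ->].
by rewrite -mulNr -rmorphN opprB.
Qed.

End SobolevNorm.

Section Data.
Local Open Scope complex_scope.
Context {R : realType}.
Local Notation normc := (@Normc.normc R).

Definition data_freq (N : nat) (i : 'I_3) : int * int :=
  nth 0 [:: (0, 0); (1, 0); (0, N%:Z)] i.

Definition data_coef (a : R) (i : 'I_3) : R[i] := nth 0 [:: 1; 1; a%:C] i.

Lemma data_freq_inj N : (0 < N)%N -> injective (data_freq N).
Proof.
by case: N => // N _ [[|[|[|//]]] ?] [[|[|[|//]]] ?] //= _; exact: val_inj.
Qed.

Definition out_freq (N : nat) : int * int := (1, N%:Z).

Let i0 : 'I_3 := @Ordinal 3 0 isT.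
Let i1 : 'I_3 := @Ordinal 3 1 isT.
Let i2 : 'I_3 := @Ordinal 3 2 isT.

(** Comparing second coordinates, either exactly one outer frequency is the high one
    and the middle frequency is low, or all three are high; first coordinates exclude
    the latter case and fix the low frequencies in the former. *)
Lemma out_freqE N (b : 'I_3 * 'I_3 * 'I_3 + 'I_3) : (0 < N)%N ->
  (wick_freq (data_freq N) b == out_freq N) =
  (b == inl (i1, i0, i2)) || (b == inl (i2, i0, i1)).
Proof.
move=> N0.
have H (i : 'I_3) : [\/ i = i0, i = i1 | i = i2].
  by case: i => -[|[|[|//]]] h; [apply: Or31|apply: Or32|apply: Or33]; apply: val_inj.
have E (u v w z : int * int) : (u - v + w == z) =
    (u.1 - v.1 + w.1 == z.1) && (u.2 - v.2 + w.2 == z.2) by [].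
case: b => [[[p q] r]|i].
  rewrite /wick_freq E.
  case: (H p) => ->; case: (H q) => ->; case: (H r) => ->;
    (rewrite -[RHS]/false || rewrite -[RHS]/true); rewrite /data_freq /=; lia.
rewrite -[RHS]/false.
by case: (H i) => ->; rewrite /wick_freq /out_freq /data_freq xpair_eqE /=; lia.
Qed.

Lemma sum_out_freq N (F : 'I_3 * 'I_3 * 'I_3 + 'I_3 -> R[i]) : (0 < N)%N ->
  \sum_(b | wick_freq (data_freq N) b == out_freq N) F b =
  F (inl (i1, i0, i2)) + F (inl (i2, i0, i1)).
Proof.
move=> N0; under eq_bigl do rewrite out_freqE//.
rewrite (bigD1 (inl (i1, i0, i2)))//= (bigD1 (inl (i2, i0, i1)))//= big1 ?addr0//.
by move=> b /andP[/andP[/orP[->|->]]].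
Qed.

Lemma sqnorm_out_freq N : sqnorm (out_freq N) = 1 + N%:R ^+ 2 :> R.
Proof. by rewrite /sqnorm /= rmorphD /= !rmorphXn /= expr1n. Qed.

(** The interaction is exactly resonant: the time oscillations of the four modes
    cancel, since [|(1, 0)|^2 + |(0, N)|^2 = |(0, 0)|^2 + |(1, N)|^2]. *)
Lemma resonant_coef N (a s : R) : (0 < N)%N ->
  \sum_(b | wick_freq (data_freq N) b == out_freq N)
    nonlinear_coef (data_coef a) (data_freq N) s b =
  expi (- (s * sqnorm (out_freq N))) * (2 * a)%:C.
Proof.
move=> N0; rewrite sum_out_freq// /nonlinear_coef /wick_coef /free_coef.
have -> : data_coef a i0 = 1 by [].
have -> : data_coef a i1 = 1 by [].
have -> : data_coef a i2 = a%:C by [].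
have -> : sqnorm (data_freq N i0) = 0 :> R by [].
have -> : sqnorm (data_freq N i1) = 1 :> R by [].
have -> : sqnorm (data_freq N i2) = N%:R ^+ 2 :> R.
  by rewrite /sqnorm /= rmorphD /= !rmorphXn /= expr0n add0r.
rewrite sqnorm_out_freq mulr0 oppr0 expi0 !mulr1 conjc1 mulrDr mulr1 opprD expiD rmorphM/=.
by rewrite rmorph_nat; ring.
Qed.

(** The phase [exp (- i (t - s) |(1, N)|^2)] of the group and the phase
    [exp (- i s |(1, N)|^2)] of [resonant_coef] multiply to one that is independent
    of [s], so the time integral is that of a constant. *)
Lemma picard_out_freq N (a t : R) : (0 < N)%N ->
  normc (picard (trig (data_coef a) (data_freq N)) t (out_freq N)) = `|t| * (2 * `|a|).
Proof.
move=> N0; rewrite /picard.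
have -> : (fun s => schrodinger (t - s) (fourier (wick_cubic
    (free_evolution (trig (data_coef a) (data_freq N)) s))) (out_freq N)) =
    (fun=> expi (- (t * sqnorm (out_freq N))) * (2 * a)%:C).
  apply/funext => s; rewrite /schrodinger fourier_wick_free; last exact: data_freq_inj.
  by rewrite resonant_coef// mulrA -expiD -opprD -mulrDl subrK.
have normC (x : R) : normc x%:C = `|x| by rewrite /= expr0n addr0 sqrtr_sqr.
rewrite oriented_integral_cst subr0 !Normc.normcM Normc.normcV normc_expi !normC normrM mul1r.
by rewrite /= expr0n expr1n add0r sqrtr1 invr1 mul1r (@ger0_norm _ 2).
Qed.

End Data.

(** * Divergence *)

Section Divergence.
Local Open Scope complex_scope.
Context {R : realType}.

(** With this coefficient [a] one has [(1 + N^2)^sigma * a^2 = 1], so that the high mode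
    contributes the same amount to the [H^sigma] norm for every [N]. *)
Definition high_coef (sigma : R) (N : nat) : R := (1 + N%:R ^+ 2) `^ (- (sigma / 2)).

Lemma sqr_high_coef sigma N : high_coef sigma N ^+ 2 = (1 + N%:R ^+ 2) `^ (- sigma) :> R.
Proof.
rewrite -powR_mulrn ?powR_ge0// /high_coef -powRrM; congr (_ `^ _).
by rewrite mulNr mulfVK.
Qed.

Definition data (sigma : R) (n : nat) : R * R -> R[i] :=
  trig (data_coef (high_coef sigma n.+1)) (data_freq n.+1).

Lemma normH_data sigma n : normH sigma (fourier (data sigma n)) =
  (((2 * pi) ^+ 2 * (2 + 2 `^ sigma)) `^ 2^-1)%:E.
Proof.
have nR (x : R) : Normc.normc x%:C = `|x| by rewrite /= expr0n addr0 sqrtr_sqr.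
rewrite normH_trig; last exact: data_freq_inj.
have sq (x y : int) : sqnorm (x, y) = x%:~R ^+ 2 + y%:~R ^+ 2 :> R.
  by rewrite /sqnorm rmorphD !rmorphXn.
congr (_ `^ _)%:E; rewrite !big_ord_recl big_ord0 addr0 /sobolev_weight.
set a := high_coef sigma n.+1.
rewrite -[LHS]/((1 + sqnorm (0, 0)) `^ sigma * (2 * pi * Normc.normc 1%:C) ^+ 2 +
  ((1 + sqnorm (1, 0)) `^ sigma * (2 * pi * Normc.normc 1%:C) ^+ 2 +
  (1 + sqnorm (0, n.+1%:Z)) `^ sigma * (2 * pi * Normc.normc a%:C) ^+ 2)).
rewrite !nR !sq normr1 mulr1 expr0n expr1n !addr0 add0r powR1.
rewrite [in X in _ + (_ + X)]exprMn real_normK ?num_real// sqr_high_coef powRN.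
have w0 : (1 + n.+1%:~R ^+ 2) `^ sigma != 0 :> R.
  by rewrite powR_eq0 negb_and gt_eqF// addr_gt0// exprn_gt0// ltr0n.
by field.
Qed.

(** The squared coefficient [(2 t a)^2] carries the factor [(1 + N^2)^(-sigma)], while
    the weight at [(1, N)] is [(2 + N^2)^sigma1]; what is left grows at least like
    [N^(sigma1 - sigma)]. *)
Lemma picard_data_ge sigma sigma1 (t : R) n : 0 <= sigma -> sigma < sigma1 ->
  (4 * pi * t) ^+ 2 * n.+1%:R `^ (sigma1 - sigma) <=
  sobolev_weight sigma1 (out_freq n.+1) (picard (data sigma n) t (out_freq n.+1)).
Proof.
move=> s0 s1; rewrite /sobolev_weight picard_out_freq// sqnorm_out_freq.
set w : R := 1 + n.+1%:R ^+ 2.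
have nw : n.+1%:R <= w.
  by rewrite /w -[leLHS]add0r lerD// ler_eXnr// ler1n.
have w0 : 0 < w by apply: lt_le_trans nw; rewrite ltr0n.
have -> : (2 * pi * (`|t| * (2 * `|high_coef sigma n.+1|))) ^+ 2 =
    (4 * pi * t) ^+ 2 * w `^ (- sigma).
  rewrite -sqr_high_coef !exprMn !real_normK ?num_real//; ring.
rewrite mulrCA ler_wpM2l ?sqr_ge0//.
apply: (@le_trans _ _ (w `^ sigma1 * w `^ (- sigma))).
  rewrite -powRD; last by rewrite (gt_eqF w0) implybT.
  by apply: ge0_ler_powR; rewrite ?nnegrE ?(ltW w0) ?ler0n// subr_ge0; exact: ltW.
apply: ler_wpM2r; first exact: powR_ge0.
rewrite ge0_ler_powR ?nnegrE ?(ltW w0)//.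
- exact: le_trans s0 (ltW s1).
- by rewrite addr_ge0// ltW.
- by rewrite lerDr.
Qed.

Lemma picard_data_divergence sigma sigma1 (t : R) : 0 <= sigma -> sigma < sigma1 ->
  t != 0 -> (fun n => normH sigma1 (picard (data sigma n) t)) @ \oo --> (+oo : \bar R)%E.
Proof.
move=> s0 s1 t0; apply/cvgeyPge => A.
pose K := (4 * pi * t) ^+ 2.
have K0 : 0 < K by rewrite exprn_even_gt0//= !mulf_neq0// gt_eqF// pi_gt0.
have d0 : 0 < sigma1 - sigma by rewrite subr_gt0.
near=> n; apply: (@le_trans _ _ (`|A|%:E)); first by rewrite lee_fin ler_norm.
apply: (normH_ge (l := out_freq n.+1)) => //.
apply: le_trans (picard_data_ge _ _ s0 s1); rewrite -/K mulrC -ler_pdivrMr//.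
(* [n] has to exceed the root of order [sigma1 - sigma] of this quotient. *)
set B := `|A| ^+ 2 / K.
have B0 : 0 <= B by rewrite divr_ge0 ?sqr_ge0// ltW.
have -> : B = (B `^ (sigma1 - sigma)^-1) `^ (sigma1 - sigma).
  by rewrite -powRrM mulVf ?powRr1// gt_eqF.
rewrite ge0_ler_powR ?nnegrE ?powR_ge0 ?ler0n ?(ltW d0)//.
apply: (@le_trans _ _ n%:R); last by rewrite ler_nat.
by near: n; exact: nbhs_infty_ger.
Unshelve. all: by end_near. Qed.

End Divergence.

Theorem proposition1p1 (R : realType) (sigma : R) (hsigma : 0 <= sigma) :
  exists (phi : nat -> R * R -> R[i]) (E : set R),
    [/\ forall n, Hs sigma (phi n),
        exists M : R, forall n, (normH sigma (fourier (phi n)) <= M%:E)%E,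
        forall n, locally_integrable_L1
          (fun s => wick_cubic (free_evolution (phi n) s)),
        countable E &
        forall t : R, ~ E t -> forall sigma1 : R, sigma < sigma1 ->
          (fun n => normH sigma1 (picard (phi n) t)) @ \oo --> (+oo : \bar R)%E].
Proof.
exists (data sigma), [set 0]; split.
- by move=> n; split; [exact: L2T2_trig|rewrite normH_data ltry].
- by eexists => n; rewrite normH_data.
- by move=> n; apply: locally_integrable_wick_free; exact: data_freq_inj.
- exact: countable1.
- by move=> t /eqP t0 sigma1 s1; exact: (picard_data_divergence hsigma s1 t0).
Qed.
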